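(* Let $\mathcal{H}_A\otimes\mathcal{H}_E$ be a finite-dimensional Hilbert space, and let $\{\ket{0},\ket{1}\}$ be orthonormal vectors in $\mathcal{H}_A$. Let $M<\infty$ be a positive integer and let $\ket{g_i^j}\in\mathcal{H}_E$ for $i=1,\dots,M$ and $j\in\{0,1\}$ be arbitrary vectors (not necessarily normalized, not necessarily orthogonal, possibly zero). Let $N>0$ be such that \[ \rho_{AE} = \frac{1}{N}\left( \ket{0}\bra{0}_A \otimes \left[ \sum_{i=1}^M \ket{g_i^0}\bra{g_i^0} \right] + \ket{1}\bra{1}_A \otimes \left[\sum_{i=1}^M\ket{g_i^1}\bra{g_i^1}\right]\right) \] is a density operator (i.e., $N$ is the normalization term). Let $N_i^j = \braket{g_i^j|g_i^j}\ge 0$. Then \[ S(A|E)_\rho \ge \sum_{i=1}^M \left( \frac{N_i^0+N_i^1}{N} \right) S_i, \] where \[ S_i = \begin{cases} h\left( \frac{N_i^0}{N_i^0+N_i^1} \right) - h(\lambda_i) & \text{if } N_i^0 > 0 \text{ and } N_i^1 > 0,\\ 0 & \text{otherwise}, \end{cases} \] and \[ \lambda_i = \frac{1}{2} + \frac{ \sqrt{(N_i^0-N_i^1)^2 + 4\left(\mathrm{Re}\braket{g_i^0|g_i^1}\right)^2} }{2(N_i^0+N_i^1)}. \]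
   Context: All logarithms are base two. $h(x) = -x\log x - (1-x)\log(1-x)$ is the binary Shannon entropy. For a density operator $\rho_{AE}$ on $\mathcal{H}_A\otimes\mathcal{H}_E$, $S(\cdot)$ denotes von Neumann entropy, $\rho_E=\mathrm{tr}_A\rho_{AE}$, and the conditional von Neumann entropy is $S(A|E)_\rho = S(\rho_{AE}) - S(\rho_E)$. *)

(* Defs.v *)
From HB Require Import structures.
From mathcomp Require Import all_boot all_order all_algebra.
From mathcomp Require Import sesquilinear spectral.
From mathcomp Require Import reals exp.
From mathcomp Require Import complex.
From mathcomp Require mxtens.
Set Implicit Arguments.
Unset Strict Implicit.
Unset Printing Implicit Defensive.
Import Order.TTheory GRing.Theory Num.Theory.
Local Open Scope ring_scope.

Section QDefs.
Variable R : realType.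
Local Notation C := R[i].

Definition adj {m n} (A : 'M[C]_(m, n)) : 'M[C]_(n, m) := (map_mx Num.conj A)^T.

Definition tens {m n} (A : 'M[C]_m) (B : 'M[C]_n) : 'M[C]_(m * n) :=
  mxtens.tensmx A B.

Definition ptraceA {m n} (rho : 'M[C]_(m * n)) : 'M[C]_n :=
  \matrix_(k, l) \sum_(i < m)
     rho (mxtens.mxtens_index (i, k)) (mxtens.mxtens_index (i, l)).

Definition psdmx {n} (A : 'M[C]_n) : Prop :=
  A \is hermsymmx /\ forall v : 'cV[C]_n, 0 <= (adj v *m A *m v) 0 0.

Definition density {n} (rho : 'M[C]_n) : Prop := psdmx rho /\ \tr rho = 1.

Definition log2 (x : R) : R := ln x / ln 2.
Definition eta (x : R) : R := if x == 0 then 0 else - (x * log2 x).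

Definition h (x : R) : R := eta x + eta (1 - x).

(* von Neumann entropy: -sum_k lambda_k log lambda_k over the eigenvalues
   (with multiplicity) of rho, obtained from its spectral decomposition
   rho = U^-1 diag(lambda) U (spectral.v). *)
Definition vN {n} (rho : 'M[C]_n) : R :=
  \sum_(k < n) eta (complex.Re (spectral_diag rho 0 k)).

Definition condS {m n} (rho : 'M[C]_(m * n)) : R := vN rho - vN (ptraceA rho).

End QDefs.

(* Main.v *)
Require Import Defs.
From HB Require Import structures.
From mathcomp Require Import all_boot all_order all_algebra.
From mathcomp Require Import sesquilinear spectral.
From mathcomp Require Import reals exp.
From mathcomp Require Import complex.
From mathcomp Require mxtens.
From mathcomp Require Import ring lra.

(* Write X_b = sum_i g_i^b (g_i^b)' / N, where ' denotes the adjoint. As rho is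
   block diagonal,
     S(A|E) = S(X_0) + S(X_1) - S(X_0 + X_1)
            = - D(X_0 || X_0 + X_1) - D(X_1 || X_0 + X_1)
   with D the relative entropy, so it suffices that D is jointly subadditive: the
   sum then splits into the terms of the index i, where X_b has rank one, X_0 + X_1
   has the spectrum of a 2 x 2 Gram matrix, and all entropies are explicit.

   Let x_j, u_j and y_k, v_k be the eigenvalues and eigenvectors of X and Y. Then
   D(X || Y) = sum_kj |<v_k, u_j>|^2 x_j (ln x_j - ln y_k), and
     x (ln x - ln y) = int_0^1 (x^2 / ((1-s) y + s x) - x) / (1-s) ds.
   For fixed s, sum_kj |<v_k, u_j>|^2 x_j^2 / ((1-s) y_k + s x_j) is the maximum
   over W of 2 Re tr(W' X) - (1-s) tr(W' Y W) - s tr(W X W'), which is linear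
   in (X, Y); hence it is subadditive. Riemann sums replace the integral. *)

Set Implicit Arguments.
Unset Strict Implicit.
Unset Printing Implicit Defensive.
Import Order.TTheory GRing.Theory Num.Theory.
Local Open Scope ring_scope.
Local Open Scope complex_scope.

Section ConditionalEntropy.
Variable R : realType.
Local Notation C := R[i].

(** * Squared moduli and real parts of complex numbers *)

Definition normsq (z : C) : R := complex.Re z ^+ 2 + complex.Im z ^+ 2.

Lemma normsqE (z : C) : conjc z * z = (normsq z)%:C.
Proof.
case: z => a b; rewrite /normsq; simpc.
by rewrite !expr2 [b * a]mulrC addrC subrr addrC.
Qed.

Lemma conjCE (z : C) : Num.conj z = conjc z.
Proof. by []. Qed.

Lemma conjR (a : R) : conjc a%:C = a%:C.
Proof. exact: conjc_real. Qed.

Lemma normsq_ge0 z : 0 <= normsq z.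
Proof. by rewrite addr_ge0 ?sqr_ge0. Qed.

Lemma normsq_eq0 z : normsq z = 0 -> z = 0.
Proof.
move=> z0; apply/eqP; rewrite -[_ == _]orbb -{1}conjc_eq0 -mulf_eq0 normsqE.
by rewrite z0.
Qed.

Lemma normsq_conj z : normsq (conjc z) = normsq z.
Proof. by case: z => a b; rewrite /normsq /= sqrrN. Qed.

Lemma normsqM z w : normsq (z * w) = normsq z * normsq w.
Proof. by apply: complexI; rewrite rmorphM /= -!normsqE rmorphM mulrACA. Qed.

Lemma normsq_real (a : R) : normsq a%:C = a ^+ 2.
Proof. by rewrite /normsq /= expr0n addr0. Qed.

Lemma ReD (z w : C) : complex.Re (z + w) = complex.Re z + complex.Re w.
Proof. by case: z w => a b [c d]. Qed.

Lemma Re_sum (I : finType) (F : I -> C) :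
  complex.Re (\sum_i F i) = \sum_i complex.Re (F i).
Proof. by apply: (big_morph (@complex.Re R)) => // z w; rewrite ReD. Qed.

Lemma ReZ (a : R) (z : C) : complex.Re (a%:C * z) = a * complex.Re z.
Proof. by case: z => x y /=; rewrite mul0r subr0. Qed.

Lemma Re_conjc (z : C) : complex.Re (conjc z) = complex.Re z.
Proof. by case: z. Qed.

(** * Adjoints and the inner product *)

Lemma adjK m n (A : 'M[C]_(m, n)) : adj (adj A) = A.
Proof. by apply/matrixP=> i j; rewrite !mxE !conjCE conjcK. Qed.

Lemma adjM m n p (A : 'M[C]_(m, n)) (B : 'M[C]_(n, p)) :
  adj (A *m B) = adj B *m adj A.
Proof. by rewrite /adj map_mxM trmx_mul. Qed.

Lemma adj_scale m n (a : C) (A : 'M[C]_(m, n)) : adj (a *: A) = conjc a *: adj A.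
Proof. by apply/matrixP=> i j; rewrite !mxE rmorphM. Qed.

Lemma adjD m n (A B : 'M[C]_(m, n)) : adj (A + B) = adj A + adj B.
Proof. by apply/matrixP=> i j; rewrite !mxE rmorphD. Qed.

Lemma adj_zero m n : adj (0 : 'M[C]_(m, n)) = 0.
Proof. by apply/matrixP=> i j; rewrite !mxE rmorph0. Qed.

Lemma adj_sum m n (I : finType) (F : I -> 'M[C]_(m, n)) :
  adj (\sum_i F i) = \sum_i adj (F i).
Proof. by apply: (big_morph (@adj R m n)); [exact: adjD | exact: adj_zero]. Qed.

Definition dot n (u v : 'cV[C]_n) : C := (adj u *m v) 0 0.

Lemma dotE n (u v : 'cV[C]_n) : adj u *m v = (dot u v)%:M.
Proof. by rewrite /dot -mx11_scalar. Qed.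

Lemma dot_conj n (u v : 'cV[C]_n) : conjc (dot u v) = dot v u.
Proof. by rewrite -[in RHS](adjK u) /dot -adjM !mxE -conjCE. Qed.

Lemma dot_sumr n (I : finType) (F : I -> 'cV[C]_n) v :
  dot v (\sum_i F i) = \sum_i dot v (F i).
Proof. by rewrite /dot mulmx_sumr summxE. Qed.

Lemma dotZr n a (u v : 'cV[C]_n) : dot u (a *: v) = a * dot u v.
Proof. by rewrite /dot -scalemxAr mxE. Qed.

Lemma dotZl n a (u v : 'cV[C]_n) : dot (a *: u) v = conjc a * dot u v.
Proof. by rewrite /dot adj_scale -scalemxAl mxE. Qed.

Lemma dot_adj m n (A : 'M[C]_(m, n)) u v :
  dot u (A *m v) = dot (adj A *m u) v.
Proof. by rewrite /dot adjM adjK mulmxA. Qed.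

Lemma dot_ge0 n (u : 'cV[C]_n) : 0 <= complex.Re (dot u u).
Proof.
rewrite /dot mxE Re_sum sumr_ge0 // => i _.
by rewrite !mxE conjCE normsqE normsq_ge0.
Qed.

Lemma dot_real n (u : 'cV[C]_n) : dot u u = (complex.Re (dot u u))%:C.
Proof.
have := dot_conj u u; case: (dot u u) => a b [] /= /esym/eqP.
by rewrite -subr_eq0 opprK -mulr2n mulrn_eq0 /= => /eqP->.
Qed.

Lemma outer_mul n m (u : 'cV[C]_m) (v w : 'cV[C]_n) :
  (u *m adj v) *m w = dot v w *: u.
Proof. by rewrite -mulmxA dotE mul_mx_scalar. Qed.

Lemma trace_sum n (I : finType) (F : I -> 'M[C]_n) :
  \tr (\sum_i F i) = \sum_i \tr (F i).
Proof. exact: linear_sum. Qed.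

(** * Spectral decomposition of Hermitian matrices *)

Definition eigval n (A : 'M[C]_n) k : R := complex.Re (spectral_diag A 0 k).
(** The decomposition is [U^-1 D U] with [U] unitary, so eigenvectors are the columns of the adjoint
    of [U]. *)
Definition eigvec n (A : 'M[C]_n) k : 'cV[C]_n := adj (row k (spectralmx A)).

Lemma adj_tr m n (A : 'M[C]_(m, n)) : adj A = map_mx Num.conj (A^T).
Proof. by rewrite /adj map_trmx. Qed.

Lemma hermP n (A : 'M[C]_n) : reflect (adj A = A) (A \is hermsymmx).
Proof.
apply: (iffP (is_hermitianmxP _ _ _)); rewrite expr0 scale1r -adj_tr.
  exact: esym.
exact: esym.
Qed.

Lemma eigvec_ortho n (A : 'M[C]_n) k l :
  dot (eigvec A k) (eigvec A l) = (k == l)%:R.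
Proof.
have /unitarymxP := spectral_unitarymx A; rewrite -adj_tr => /matrixP/(_ k l).
rewrite !mxE => <-; rewrite /dot mxE; apply: eq_bigr => i _.
by rewrite !mxE !conjCE conjcK.
Qed.

Lemma eigvec_sum n (A : 'M[C]_n) :
  \sum_k eigvec A k *m adj (eigvec A k) = 1%:M.
Proof.
have := mulVmx (spectral_unit A).
rewrite invmx_unitary ?spectral_unitarymx // -adj_tr => <-.
apply/matrixP => i j; rewrite summxE !mxE; apply: eq_bigr => k _.
by rewrite !mxE big_ord1 !mxE !conjCE conjcK.
Qed.

Lemma herm_spectral n (A : 'M[C]_n) : adj A = A ->
  A = \sum_k (eigval A k)%:C *: (eigvec A k *m adj (eigvec A k)).
Proof.
move=> /hermP hA; have /orthomx_spectralP := hermitian_normalmx hA.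
rewrite invmx_unitary ?spectral_unitarymx // -adj_tr => {1}->.
apply/matrixP => i j; rewrite summxE !mxE; apply: eq_bigr => k _.
have /mxOverP/(_ 0 k) rk := hermitian_spectral_diag_real hA.
rewrite !mxE big_ord1 !mxE (bigD1 k) //= big1 ?addr0 => [|l /negPf kl].
  by rewrite !mxE eqxx mulr1n (RRe_real rk) !conjCE !conjcK; ring.
by rewrite !mxE kl mulr0n mulr0.
Qed.

Lemma eigvecP n (A : 'M[C]_n) k : adj A = A ->
  A *m eigvec A k = (eigval A k)%:C *: eigvec A k.
Proof.
move=> hA; rewrite {1}[A in A *m _](herm_spectral hA) mulmx_suml.
rewrite (bigD1 k) //= big1 ?addr0 => [|l /negPf kl].
  by rewrite -scalemxAl outer_mul eigvec_ortho eqxx scale1r.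
by rewrite -scalemxAl outer_mul eigvec_ortho kl scale0r scaler0.
Qed.

Lemma parseval n (A : 'M[C]_n) u v :
  \sum_k dot u (eigvec A k) * dot (eigvec A k) v = dot u v.
Proof.
rewrite -[v in RHS]mul1mx -(eigvec_sum A) mulmx_suml dot_sumr.
by apply: eq_bigr => k _; rewrite outer_mul dotZr mulrC.
Qed.

Lemma parseval_normsq n (A : 'M[C]_n) u :
  \sum_k normsq (dot (eigvec A k) u) = complex.Re (dot u u).
Proof.
rewrite -(parseval A) Re_sum; apply: eq_bigr => k _.
by rewrite -[X in X * _]dot_conj normsqE.
Qed.

(** * Entropy read off from a family of eigenvectors *)

Lemma etaE (x : R) : Defs.eta x = x * - (ln x / ln 2).
Proof.
by rewrite /Defs.eta /log2; have [->|_] := eqVneq x 0; rewrite ?mul0r // mulrN.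
Qed.

(* Overlap argument: [<e_k, v_j>] vanishes unless the eigenvalues of [e_k]
   and [v_j] agree, and the squared overlaps have marginals [a_k] and [d_j]. *)
Lemma vN_family n (J : finType) (A : 'M[C]_n) (w d : J -> R) (v : J -> 'cV[C]_n) :
  A = \sum_j (w j)%:C *: (v j *m adj (v j)) ->
  (forall j, A *m v j = (d j)%:C *: v j) ->
  (forall j, w j * complex.Re (dot (v j) (v j)) = d j) ->
  vN A = \sum_j Defs.eta (d j).
Proof.
move=> Adef Av wd.
have hA : adj A = A.
  rewrite Adef adj_sum; apply: eq_bigr => j _.
  by rewrite adj_scale adjM adjK conjR.
pose o k j := normsq (dot (eigvec A k) (v j)).
have o_eig k j : o k j != 0 -> eigval A k = d j.
  move=> o0.
  have : dot (eigvec A k) (A *m v j) = dot (adj A *m eigvec A k) (v j).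
    exact: dot_adj.
  rewrite hA Av eigvecP // dotZr dotZl conjR => /eqP.
  rewrite -subr_eq0 -mulrBl mulf_eq0 => /orP[|/eqP o00]; last first.
    by move: o0; rewrite /o o00 /normsq /= expr0n addr0 eqxx.
  by rewrite subr_eq0 => /eqP/complexI.
have row_sum k : \sum_j w j * o k j = eigval A k.
  have := congr1 (@complex.Re R) (dotZr (eigval A k)%:C (eigvec A k) (eigvec A k)).
  rewrite -eigvecP // eigvec_ortho eqxx mulr1 /= => <-.
  set e := eigvec A k; rewrite Adef mulmx_suml dot_sumr Re_sum; apply: eq_bigr => j _.
  rewrite -scalemxAl outer_mul !dotZr ReZ; congr (_ * _).
  by rewrite -[dot (v j) _]dot_conj normsqE.
have col_sum j : \sum_k w j * o k j = d j.
  by rewrite -mulr_sumr parseval_normsq wd.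
transitivity (\sum_k \sum_j w j * o k j * - (ln (d j) / ln 2)).
  apply: eq_bigr => k _; rewrite etaE -/(eigval A k) -{1}row_sum mulr_suml.
  apply: eq_bigr => j _; have [->|/o_eig ->//] := eqVneq (o k j) 0.
  by rewrite mulr0 !mul0r.
rewrite exchange_big; apply: eq_bigr => j _.
by rewrite -mulr_suml col_sum etaE.
Qed.

(** * Riemann sums for [x * (ln x - ln y)] *)

(** By concavity, the tangent of [ln] at [a] lies above the graph. *)
Lemma ln_sub_le (a b : R) : 0 < a -> 0 < b -> ln b - ln a <= (b - a) / a.
Proof.
move=> a0 b0; rewrite -ln_div ?posrE // mulrBl divff ?gt_eqF //.
have {1}-> : b / a = 1 + (b / a - 1) by rewrite addrC subrK.
by apply: le_ln1Dx; rewrite ltrBDl subrr divr_gt0.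
Qed.

(* Summand of the Riemann sum of [x * ln (x / y)], written as the integral of
   [x (x - y) / ((1 - u) y + u x)] over [u] in [[0, 1]]. *)
Definition relq (u x y : R) : R := x * (x - y) / ((1 - u) * y + u * x).

Section Riemann.
Variables (n : nat) (x y : R).
Hypotheses (x0 : 0 < x) (y0 : 0 < y).

(** The denominators of [relq] at the nodes; they run from [y] to [x] in equal steps, so
    [ln x - ln y] telescopes along them. *)
Let a k : R := (1 - k%:R / n.+1%:R) * y + k%:R / n.+1%:R * x.

Let aS k : a k.+1 - a k = (x - y) / n.+1%:R.
Proof. by rewrite /a -[k.+1%:R]natr1; field; rewrite nat1r pnatr_eq0. Qed.

Let a0E : a 0 = y.
Proof. by rewrite /a mul0r subr0 mul1r mul0r addr0. Qed.

Let anE : a n.+1 = x.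
Proof. by rewrite /a divff ?pnatr_eq0 // subrr mul0r mul1r add0r. Qed.

Let a_gt0 k : (k <= n.+1)%N -> 0 < a k.
Proof.
move=> kn.
have u0 : 0 <= k%:R / n.+1%:R :> R by rewrite divr_ge0.
have u1 : k%:R / n.+1%:R <= 1 :> R by rewrite ler_pdivrMr ?mul1r ?ler_nat ?ltr0n.
rewrite /a; set u := _ / _ in u0 u1 *.
have [->|u00] := eqVneq u 0; first by rewrite subr0 mul1r mul0r addr0.
rewrite ltr_wpDl ?mulr_ge0 ?subr_ge0 ?(ltW y0) //.
by rewrite mulr_gt0 // lt_def u00.
Qed.

Let lnE : ln x - ln y = \sum_(k < n.+1) (ln (a k.+1) - ln (a k)).
Proof.
rewrite -(big_mkord xpredT (fun k => ln (a k.+1) - ln (a k))).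
by rewrite telescope_sumr // anE a0E.
Qed.

(** The tangent at the left end [a k] bounds each logarithmic step from above, whatever the sign of
    [x - y]. *)
Lemma riemann_ge :
  x * (ln x - ln y) <= n.+1%:R^-1 * \sum_(k < n.+1) relq (k%:R / n.+1%:R) x y.
Proof.
rewrite lnE !mulr_sumr; apply: ler_sum => k _.
have ak := a_gt0 (ltnW (ltn_ord k)); have akS := a_gt0 (ltn_ord k).
have := ler_wpM2l (ltW x0) (ln_sub_le ak akS); rewrite aS => /le_trans; apply.
by rewrite /relq -/(a k) le_eqVlt; apply/orP; left; apply/eqP; ring.
Qed.

(** The tangent at the right end bounds each step from below. The gap between the two tangent bounds
    is a multiple of [1 / a k - 1 / a k.+1], which telescopes to the error term. *)
Lemma riemann_le :
  n.+1%:R^-1 * (\sum_(k < n.+1) relq (k%:R / n.+1%:R) x y)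
    <= x * (ln x - ln y) + (x - y) ^+ 2 / y / n.+1%:R.
Proof.
rewrite -lerBlDl lnE !mulr_sumr -sumrB.
have -> : (x - y) ^+ 2 / y / n.+1%:R =
    \sum_(k < n.+1) (x * (x - y) / n.+1%:R * - ((a k.+1)^-1 - (a k)^-1)).
  rewrite -mulr_sumr sumrN -(big_mkord xpredT (fun k => (a k.+1)^-1 - (a k)^-1)).
  rewrite telescope_sumr // anE a0E; field.
  by rewrite nat1r pnatr_eq0 !gt_eqF.
apply: ler_sum => k _.
have ak := a_gt0 (ltnW (ltn_ord k)); have akS := a_gt0 (ltn_ord k).
have := ler_wpM2l (ltW x0) (ln_sub_le akS ak).
rewrite -[a k - _]opprB aS /relq -/(a k) => h1.
have -> : x * (x - y) / n.+1%:R * - ((a k.+1)^-1 - (a k)^-1) =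
  n.+1%:R^-1 * (x * (x - y) / a k) + x * (- ((x - y) / n.+1%:R) / a k.+1) by ring.
by rewrite -mulrN opprB lerD2l.
Qed.

End Riemann.

(** * Positive semidefinite matrices *)

Definition posmx n (A : 'M[C]_n) : Prop :=
  adj A = A /\ forall v, 0 <= complex.Re (dot v (A *m v)).

Lemma posmxD n (A B : 'M[C]_n) : posmx A -> posmx B -> posmx (A + B).
Proof.
move=> [hA pA] [hB pB]; split; first by rewrite adjD hA hB.
by move=> v; rewrite mulmxDl /dot mulmxDr mxE ReD addr_ge0 ?pA ?pB.
Qed.

Lemma posmx_sum n (I : finType) (F : I -> 'M[C]_n) :
  (forall i, posmx (F i)) -> posmx (\sum_i F i).
Proof.
move=> pF; apply: (big_ind (@posmx n)) => [|A B|i _]; [|exact: posmxD|exact: pF].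
split=> [|v]; first exact: adj_zero.
by rewrite mul0mx /dot mulmx0 mxE.
Qed.

Lemma dot_eigvec n (A : 'M[C]_n) k : adj A = A ->
  complex.Re (dot (eigvec A k) (A *m eigvec A k)) = eigval A k.
Proof. by move=> hA; rewrite eigvecP // dotZr eigvec_ortho eqxx mulr1. Qed.

Lemma eigval_ge0 n (A : 'M[C]_n) k : posmx A -> 0 <= eigval A k.
Proof. by move=> [hA pA]; rewrite -dot_eigvec. Qed.

Lemma trace_spectral n (A B : 'M[C]_n) : adj A = A ->
  \tr (B *m A) = \sum_j (eigval A j)%:C * dot (eigvec A j) (B *m eigvec A j).
Proof.
move=> hA; rewrite {1}(herm_spectral hA) mulmx_sumr trace_sum.
apply: eq_bigr => j _; rewrite -scalemxAr linearZ /= mulmxA mxtrace_mulC.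
by rewrite dotE mxtrace_scalar mulr1n.
Qed.

(** * The variational formula at a fixed integration parameter [u] *)

Definition overlap n (X Y : 'M[C]_n) k j : C := dot (eigvec Y k) (eigvec X j).

Definition qform n u (W X Y : 'M[C]_n) : R :=
  complex.Re (\tr (adj W *m X)) *+ 2
  - (1 - u) * complex.Re (\tr (adj W *m Y *m W))
  - u * complex.Re (\tr (W *m X *m adj W)).

Definition quasi n u (X Y : 'M[C]_n) : R :=
  \sum_k \sum_j normsq (overlap X Y k j) * (eigval X j ^+ 2 /
    ((1 - u) * eigval Y k + u * eigval X j)).

(** Relative entropy in natural logarithms. No infinite value is provided: in every comparison below
    [Y] is [X] plus a positive semidefinite matrix, and then the terms with [eigval Y k = 0]
    vanish. *)
Definition relent n (X Y : 'M[C]_n) : R :=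
  \sum_k \sum_j normsq (overlap X Y k j) *
    (eigval X j * (ln (eigval X j) - ln (eigval Y k))).

Lemma qform_sum n u (W : 'M[C]_n) (I : finType) (X Y : I -> 'M[C]_n) :
  qform u W (\sum_i X i) (\sum_i Y i) = \sum_i qform u W (X i) (Y i).
Proof.
rewrite /qform !mulmx_sumr !mulmx_suml !trace_sum !Re_sum.
by rewrite !sumrB -sumrMnl !mulr_sumr.
Qed.

(** In the eigenbases of [Y] and [X] the form decouples into one quadratic per entry [w] of [W], so
    it can be maximised entry by entry. *)
Lemma qformE n u (W X Y : 'M[C]_n) : adj X = X -> adj Y = Y ->
  qform u W X Y = \sum_k \sum_j
    let w := dot (eigvec Y k) (W *m eigvec X j) in
    (eigval X j * complex.Re (conjc w * overlap X Y k j) *+ 2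
     - ((1 - u) * eigval Y k + u * eigval X j) * normsq w).
Proof.
move=> hX hY.
pose w k j := dot (eigvec Y k) (W *m eigvec X j).
have adjW k j : normsq (dot (eigvec X j) (adj W *m eigvec Y k)) = normsq (w k j).
  by rewrite dot_adj adjK -dot_conj normsq_conj.
have t1 : complex.Re (\tr (adj W *m X)) =
    \sum_k \sum_j eigval X j * complex.Re (conjc (w k j) * overlap X Y k j).
  rewrite trace_spectral // Re_sum exchange_big; apply: eq_bigr => j _.
  rewrite ReZ dot_adj adjK -(parseval Y) Re_sum mulr_sumr.
  by apply: eq_bigr => k _; rewrite dot_conj.
have t2 : complex.Re (\tr (adj W *m Y *m W)) =
    \sum_k \sum_j eigval Y k * normsq (w k j).
  rewrite mxtrace_mulC mulmxA trace_spectral // Re_sum; apply: eq_bigr => k _.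
  rewrite ReZ -mulmxA dot_adj -(parseval_normsq X) mulr_sumr.
  by apply: eq_bigr => j _; rewrite adjW.
have t3 : complex.Re (\tr (W *m X *m adj W)) =
    \sum_k \sum_j eigval X j * normsq (w k j).
  rewrite mxtrace_mulC mulmxA trace_spectral // Re_sum exchange_big.
  apply: eq_bigr => j _; rewrite ReZ -mulmxA dot_adj adjK.
  by rewrite -(parseval_normsq Y) mulr_sumr.
rewrite /qform t1 t2 t3 -sumrMnl !mulr_sumr -!sumrB; apply: eq_bigr => k _.
rewrite -sumrMnl !mulr_sumr -!sumrB; apply: eq_bigr => j _.
by rewrite -/(w k j); ring.
Qed.

Section Variational.
Variables (n : nat) (u : R) (X Y : 'M[C]_n).
Hypotheses (u0 : 0 <= u) (u1 : u < 1) (pX : posmx X) (pY : posmx Y).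
(** The support of [X] lies in that of [Y]; numerators thus vanish wherever the denominator [den]
    does. *)
Hypothesis supp :
  forall k j, eigval Y k = 0 -> normsq (overlap X Y k j) * eigval X j = 0.

Let den k j := (1 - u) * eigval Y k + u * eigval X j.

Let den_ge0 k j : 0 <= den k j.
Proof.
by rewrite addr_ge0 // mulr_ge0 ?eigval_ge0 // subr_ge0 ltW.
Qed.

Let den_eq0 k j : den k j = 0 -> eigval Y k = 0.
Proof.
move/eqP; rewrite paddr_eq0 ?mulr_ge0 ?eigval_ge0 ?subr_ge0 ?(ltW u1) //.
by move=> /andP[]; rewrite mulf_eq0 subr_eq0 gt_eqF //= => /eqP.
Qed.

(** Completing the square in each entry: the gap is [|den w - x o|^2 / den]. Where [den] is zero,
    both sides are zero by [supp]. *)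
Lemma qform_le W : qform u W X Y <= quasi u X Y.
Proof.
rewrite qformE; [|by case: pX|by case: pY].
apply: ler_sum => k _; apply: ler_sum => j _ /=.
rewrite -/(den k j); set w := dot _ _; set o := overlap _ _ _ _.
have [d0|d0] := eqVneq (den k j) 0.
  have /eqP := supp j (den_eq0 d0).
  rewrite -/o d0 invr0 !mulr0 mul0r subr0 mulf_eq0 => /orP[/eqP/normsq_eq0 ->|/eqP ->].
    by rewrite mulr0 /= mulr0 mul0rn.
  by rewrite mul0r mul0rn.
have d_gt0 : 0 < den k j by rewrite lt_def d0 den_ge0.
rewrite mulrA ler_pdivlMr //.
move: w o (den k j) (eigval X j) d_gt0 => [a b] [c e] d x d_gt0.
rewrite /normsq /= -subr_ge0.
set z := (X in 0 <= X).
have -> : z = (d * a - x * c) ^+ 2 + (d * b - x * e) ^+ 2 by rewrite /z; ring.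
by rewrite addr_ge0 ?sqr_ge0.
Qed.

Lemma qform_max : exists W, qform u W X Y = quasi u X Y.
Proof.
(* The entries at which the completed square vanishes; where [den] is zero, the convention
   [x / 0 = 0] makes them 0. *)
pose c k j : C := (eigval X j / den k j)%:C * overlap X Y k j.
pose W : 'M[C]_n := \sum_k \sum_j c k j *: (eigvec Y k *m adj (eigvec X j)).
have Wc k j : dot (eigvec Y k) (W *m eigvec X j) = c k j.
  rewrite /W mulmx_suml dot_sumr (bigD1 k) //= [X in _ + X]big1 ?addr0 => [|l /negPf lk].
    rewrite mulmx_suml dot_sumr (bigD1 j) //= big1 ?addr0 => [|l /negPf lj].
      by rewrite -scalemxAl outer_mul !dotZr !eigvec_ortho !eqxx !mulr1.
    by rewrite -scalemxAl outer_mul !dotZr !eigvec_ortho lj mul0r mulr0.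
  rewrite mulmx_suml dot_sumr big1 // => j' _.
  by rewrite -scalemxAl outer_mul !dotZr !eigvec_ortho [k == l]eq_sym lk !mulr0.
exists W; rewrite qformE; [|by case: pX|by case: pY].
apply: eq_bigr => k _; apply: eq_bigr => j _ /=.
have Re_scaled a z : complex.Re (conjc (a%:C * z) * z) = a * normsq z.
  by case: z => z1 z2; rewrite /normsq /=; ring.
rewrite Wc -/(den k j) /c normsqM normsq_real Re_scaled.
have [->|d0] := eqVneq (den k j) 0; last by field.
by rewrite invr0; ring.
Qed.

(** Termwise [x ^+ 2 / den - x = (1 - u) * relq u x y], and by Parseval the overlaps of each [j] sum
    to one over [k], so the linear terms add up to the trace. *)
Lemma relq_sum :
  \sum_k \sum_j normsq (overlap X Y k j) * relq u (eigval X j) (eigval Y k)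
    = (quasi u X Y - complex.Re (\tr X)) / (1 - u).
Proof.
have -> : complex.Re (\tr X) =
    \sum_k \sum_j normsq (overlap X Y k j) * eigval X j.
  rewrite -[X in \tr X]mul1mx trace_spectral; last by case: pX.
  rewrite Re_sum exchange_big; apply: eq_bigr => j _.
  by rewrite mul1mx ReZ -mulr_suml (parseval_normsq Y) mulrC.
rewrite -sumrB mulr_suml; apply: eq_bigr => k _.
rewrite -sumrB mulr_suml; apply: eq_bigr => j _.
rewrite -mulrBr /relq -/(den k j); have [d0|d0] := eqVneq (den k j) 0.
  have := supp j (den_eq0 d0).
  by rewrite d0 invr0 !mulr0 sub0r mulrN => ->; rewrite oppr0 mul0r.
move: d0; rewrite /den => d0; field.
by rewrite d0 subr_eq0 gt_eqF.
Qed.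

End Variational.

Lemma dot_overlap n (X Y : 'M[C]_n) k : adj X = X ->
  complex.Re (dot (eigvec Y k) (X *m eigvec Y k)) =
  \sum_j normsq (overlap X Y k j) * eigval X j.
Proof.
move=> hX; rewrite {1}(herm_spectral hX) mulmx_suml dot_sumr Re_sum.
apply: eq_bigr => j _; rewrite -scalemxAl outer_mul !dotZr ReZ mulrC.
by rewrite -[dot (eigvec X j) _]dot_conj normsqE.
Qed.

(** On a null vector of [X + Z] both nonnegative quadratic forms vanish; that of [X] is a sum of
    nonnegative overlap terms, so each of them is zero. *)
Lemma support_sum n (X Z : 'M[C]_n) : posmx X -> posmx Z ->
  forall k j, eigval (X + Z) k = 0 ->
    normsq (overlap X (X + Z) k j) * eigval X j = 0.
Proof.
move=> pX pZ k j; have [hY _] := posmxD pX pZ.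
rewrite -dot_eigvec // mulmxDl /dot mulmxDr mxE ReD => /eqP.
rewrite paddr_eq0; [|exact: (proj2 pX)|exact: (proj2 pZ)] => /andP[/eqP + _].
rewrite dot_overlap; last by case: pX.
move/eqP; rewrite psumr_eq0 => [/allP/(_ j (mem_index_enum j))/eqP //|l _].
by rewrite mulr_ge0 ?normsq_ge0 ?eigval_ge0.
Qed.

(** * Relative entropy against its Riemann sums *)

(** Left endpoints keep the parameter below 1, away from the zero of [1 - u]. Stated through
    [quasi], so that subadditivity passes to it term by term. *)
Definition riemann n m (X Y : 'M[C]_n) : R :=
  m.+1%:R^-1 * \sum_(l < m.+1)
    ((quasi (l%:R / m.+1%:R) X Y - complex.Re (\tr X)) / (1 - l%:R / m.+1%:R)).

Lemma unit_frac m (l : 'I_m.+1) : 0 <= l%:R / m.+1%:R :> R /\ l%:R / m.+1%:R < 1 :> R.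
Proof.
split; first by rewrite divr_ge0.
by rewrite ltr_pdivrMr ?ltr0n // mul1r ltr_nat ltn_ord.
Qed.

Section Comparison.
Variables (n : nat) (X Z : 'M[C]_n).
Hypotheses (pX : posmx X) (pZ : posmx Z).
Let Y := X + Z.

Let riemannE m : riemann m X Y = \sum_k \sum_j normsq (overlap X Y k j) *
  (m.+1%:R^-1 * \sum_(l < m.+1) relq (l%:R / m.+1%:R) (eigval X j) (eigval Y k)).
Proof.
have pY : posmx Y by exact: posmxD.
transitivity (m.+1%:R^-1 * \sum_(l < m.+1) \sum_k \sum_j
   normsq (overlap X Y k j) * relq (l%:R / m.+1%:R) (eigval X j) (eigval Y k)).
  congr (_ * _); apply: eq_bigr => l _; have [u0 u1] := unit_frac l.
  by rewrite relq_sum //; exact: support_sum.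
rewrite exchange_big mulr_sumr; apply: eq_bigr => k _.
rewrite exchange_big mulr_sumr; apply: eq_bigr => j _.
by rewrite mulrCA -mulr_sumr.
Qed.

Let relq0 u (y : R) : relq u 0 y = 0.
Proof. by rewrite /relq !mul0r. Qed.

Lemma relent_le_riemann m : relent X Y <= riemann m X Y.
Proof.
have pY : posmx Y by exact: posmxD.
rewrite riemannE; apply: ler_sum => k _; apply: ler_sum => j _.
have [x0|x0] := eqVneq (eigval X j) 0.
  by rewrite x0 mul0r big1 ?mulr0 // => l _; rewrite relq0.
have [y0|y0] := eqVneq (eigval Y k) 0.
  have /eqP := support_sum pX pZ j y0.
  by rewrite mulf_eq0 (negPf x0) orbF => /eqP ->; rewrite !mul0r.
rewrite ler_wpM2l ?normsq_ge0 // riemann_ge //.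
  by rewrite lt_def x0 eigval_ge0.
by rewrite lt_def y0 eigval_ge0.
Qed.

Lemma riemann_le_relent : exists c, forall m, riemann m X Y <= relent X Y + c / m.+1%:R.
Proof.
have pY : posmx Y by exact: posmxD.
(* The scalar error terms weighted by the overlaps, with no dependence on [m]. *)
exists (\sum_k \sum_j normsq (overlap X Y k j) *
  ((eigval X j - eigval Y k) ^+ 2 / eigval Y k)) => m.
rewrite riemannE mulr_suml -big_split; apply: ler_sum => k _.
rewrite mulr_suml -big_split; apply: ler_sum => j _ /=.
rewrite -mulrA -mulrDr.
have [x0|x0] := eqVneq (eigval X j) 0.
  rewrite x0 mul0r add0r big1 ?mulr0 => [|l _]; last by rewrite relq0.
  by rewrite mulr_ge0 ?normsq_ge0 // !divr_ge0 ?sqr_ge0 ?eigval_ge0.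
have [y0|y0] := eqVneq (eigval Y k) 0.
  have /eqP := support_sum pX pZ j y0.
  by rewrite mulf_eq0 (negPf x0) orbF => /eqP ->; rewrite !mul0r.
rewrite ler_wpM2l ?normsq_ge0 // riemann_le //.
  by rewrite lt_def x0 eigval_ge0.
by rewrite lt_def y0 eigval_ge0.
Qed.

End Comparison.

(** * Joint subadditivity of relative entropy *)

Section Subadditivity.
Variables (n : nat) (I : finType) (X Z : I -> 'M[C]_n).
Hypotheses (pX : forall i, posmx (X i)) (pZ : forall i, posmx (Z i)).

(** The [W] that is optimal for the sums is a competitor for every summand, and [qform] is additive
    in the pair of matrices. *)
Let quasi_sum u : 0 <= u -> u < 1 ->
  quasi u (\sum_i X i) (\sum_i X i + \sum_i Z i)
    <= \sum_i quasi u (X i) (X i + Z i).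
Proof.
move=> u0 u1; have pSX := posmx_sum pX; have pSZ := posmx_sum pZ.
have pY := posmxD pSX pSZ.
have [W <-] := qform_max u pSX pY.
rewrite -big_split qform_sum; apply: ler_sum => i _.
by apply: qform_le => //; [exact: posmxD | exact: support_sum].
Qed.

Lemma relent_sum : relent (\sum_i X i) (\sum_i X i + \sum_i Z i)
  <= \sum_i relent (X i) (X i + Z i).
Proof.
have pSX := posmx_sum pX; have pSZ := posmx_sum pZ.
have riemann_sum m : riemann m (\sum_i X i) (\sum_i X i + \sum_i Z i)
    <= \sum_i riemann m (X i) (X i + Z i).
  rewrite -mulr_sumr ler_wpM2l ?invr_ge0 // exchange_big; apply: ler_sum => l _.
  have [u0 u1] := unit_frac l.
  rewrite -mulr_suml ler_wpM2r ?invr_ge0 ?subr_ge0 ?(ltW u1) // sumrB.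
  by rewrite trace_sum Re_sum lerB // quasi_sum.
have [c cP] : exists c : I -> R, forall i m,
    riemann m (X i) (X i + Z i) <= relent (X i) (X i + Z i) + c i / m.+1%:R.
  have /fin_all_exists [c cP] i := riemann_le_relent (pX i) (pZ i).
  by exists c.
have bound m := le_trans (relent_le_riemann pSX pSZ m)
  (le_trans (riemann_sum m) (ler_sum _ (fun i _ => cP i m))).
rewrite leNgt; apply/negP => lt; move: bound.
set lhs := relent _ _ in lt *; set rhs := \sum_i relent _ _ in lt *.
set K := \sum_i c i => bound.
have {}bound m : lhs - rhs <= K / m.+1%:R.
  by rewrite lerBlDl (le_trans (bound m)) // big_split /= -mulr_suml.
have d0 : 0 < lhs - rhs by rewrite subr_gt0.
(* A positive gap would give [m + 1 <= K / (lhs - rhs)] for every [m], against the Archimedean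
   property. *)
have K0 : 0 <= K / (lhs - rhs).
  by rewrite divr_ge0 ?(ltW d0) // (le_trans (ltW d0)) // -[K]divr1 (bound 0).
have := archi_boundP K0; set m := Num.bound _ => lt_m.
have := bound m; rewrite ler_pdivlMr ?ltr0n // -ler_pdivlMl // mulrC => le_m.
by have := le_lt_trans le_m lt_m; rewrite ltr_nat ltnNge leqnSn.
Qed.

End Subadditivity.

(** * Conditional entropy as a sum of relative entropies *)

Lemma ln2_gt0 : 0 < ln 2 :> R.
Proof. by rewrite ln_gt0 // ltr1n. Qed.

(** This is tr(X ln X) - tr(X ln Y), traced in the eigenbases; [ln 2] converts from base two. *)
Lemma relentE n (X Y : 'M[C]_n) : adj X = X ->
  relent X Y = - (ln 2 * vN X) -
    \sum_k complex.Re (dot (eigvec Y k) (X *m eigvec Y k)) * ln (eigval Y k).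
Proof.
move=> hX.
have -> : - (ln 2 * vN X) =
    \sum_k \sum_j normsq (overlap X Y k j) * (eigval X j * ln (eigval X j)).
  rewrite exchange_big mulr_sumr -sumrN; apply: eq_bigr => j _.
  rewrite -mulr_suml parseval_normsq eigvec_ortho eqxx mul1r etaE -/(eigval X j).
  by field; rewrite gt_eqF ?ln2_gt0.
rewrite -sumrB; apply: eq_bigr => k _.
rewrite dot_overlap // mulr_suml -sumrB; apply: eq_bigr => j _; ring.
Qed.

(** The trace defining the entropy of [X + Y] splits linearly into an [X] part and a [Y] part, one
    for each relative entropy. *)
Lemma cond_entropyE n (X Y : 'M[C]_n) : posmx X -> posmx Y ->
  vN X + vN Y - vN (X + Y) =
  - (relent X (X + Y) + relent Y (Y + X)) / ln 2.
Proof.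
move=> [hX _] [hY _]; have hS : adj (X + Y) = X + Y by rewrite adjD hX hY.
have vS : ln 2 * vN (X + Y) = - \sum_k complex.Re
    (dot (eigvec (X + Y) k) ((X + Y) *m eigvec (X + Y) k)) * ln (eigval (X + Y) k).
  rewrite mulr_sumr -sumrN; apply: eq_bigr => k _.
  rewrite dot_eigvec // etaE -/(eigval (X + Y) k).
  by field; rewrite gt_eqF ?ln2_gt0.
have := vS; under eq_bigr do rewrite mulmxDl /dot mulmxDr mxE ReD mulrDl.
rewrite big_split /= opprD => {}vS.
rewrite [Y + X]addrC !relentE //.
have l2 : ln 2 != 0 :> R by rewrite gt_eqF ?ln2_gt0.
apply: (mulfI l2); rewrite mulrBr vS /dot; field; exact: l2.
Qed.

Lemma cond_entropy_sum n (I : finType) (X Y : I -> 'M[C]_n) :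
  (forall i, posmx (X i)) -> (forall i, posmx (Y i)) ->
  \sum_i (vN (X i) + vN (Y i) - vN (X i + Y i)) <=
  vN (\sum_i X i) + vN (\sum_i Y i) - vN (\sum_i X i + \sum_i Y i).
Proof.
move=> pX pY; rewrite cond_entropyE; try exact: posmx_sum.
under eq_bigr do rewrite cond_entropyE //.
rewrite -mulr_suml ler_pM2r ?invr_gt0 ?ln2_gt0 // sumrN lerN2 big_split /=.
by rewrite lerD // relent_sum.
Qed.

(** * Entropies of matrices of rank at most two *)

Lemma posmx_outer n (t : R) (g : 'cV[C]_n) : 0 <= t -> posmx (t%:C *: (g *m adj g)).
Proof.
move=> t0; split=> [|v]; first by rewrite adj_scale conjR adjM adjK.
rewrite -scalemxAl outer_mul !dotZr ReZ mulr_ge0 //.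
by rewrite -[dot v g]dot_conj mulrC normsqE normsq_ge0.
Qed.

Lemma vN_outer n (t : R) (g : 'cV[C]_n) :
  vN (t%:C *: (g *m adj g)) = Defs.eta (t * complex.Re (dot g g)).
Proof.
rewrite (@vN_family _ unit _ (fun=> t) (fun=> t * complex.Re (dot g g)) (fun=> g)) //.
- by rewrite big_const card_unit /= addr0.
- by rewrite big_const card_unit /= addr0.
- by move=> _; rewrite -scalemxAl outer_mul scalerA rmorphM /= -dot_real.
Qed.

Lemma posmx_gram m n (G : 'M[C]_(m, n)) : posmx (adj G *m G).
Proof.
split=> [|v]; first by rewrite adjM adjK.
by rewrite -mulmxA dot_adj adjK dot_ge0.
Qed.

(** [G] maps the eigenvectors of [adj G *m G] to eigenvectors of [G *m adj G] with the same
    eigenvalues, which are also their squared norms. Zero images contribute no entropy. *)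
Lemma vN_gram m n (t : R) (G : 'M[C]_(m, n)) :
  vN (t%:C *: (G *m adj G)) = \sum_j Defs.eta (t * eigval (adj G *m G) j).
Proof.
have [hK _] := posmx_gram G.
apply: (@vN_family _ _ _ (fun=> t) _ (fun j => G *m eigvec (adj G *m G) j)).
- rewrite -scaler_sumr; congr (_ *: _).
  rewrite -[adj G in LHS]mul1mx -(eigvec_sum (adj G *m G)) mulmx_suml mulmx_sumr.
  by apply: eq_bigr => j _; rewrite adjM !mulmxA.
- move=> j; rewrite -scalemxAl -!mulmxA [adj G *m (_ *m _)]mulmxA eigvecP //.
  by rewrite -scalemxAr scalerA -rmorphM.
- by move=> j; rewrite dot_adj -dot_conj Re_conjc mulmxA dot_eigvec.
Qed.

(* [k0] and [k1] are the eigenvalues of the Gram matrix of [g0] and [g1]. *)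
Lemma vN_outer2 n (t : R) (g0 g1 : 'cV[C]_n) : exists k0 k1 : R,
  [/\ 0 <= k0, 0 <= k1,
      k0 + k1 = complex.Re (dot g0 g0) + complex.Re (dot g1 g1),
      (k0 - k1) ^+ 2 = (complex.Re (dot g0 g0) - complex.Re (dot g1 g1)) ^+ 2
                       + 4 * normsq (dot g0 g1)
    & vN (t%:C *: (g0 *m adj g0) + t%:C *: (g1 *m adj g1))
      = Defs.eta (t * k0) + Defs.eta (t * k1)].
Proof.
pose G : 'M[C]_(n, 1 + 1) := row_mx g0 g1.
have GE : G *m adj G = g0 *m adj g0 + g1 *m adj g1.
  by rewrite /G /adj map_row_mx tr_row_mx mul_row_col.
have KE : adj G *m G = block_mx (dot g0 g0)%:M (dot g0 g1)%:M
                                (dot g1 g0)%:M (dot g1 g1)%:M.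
  by rewrite /G {1}/adj map_row_mx tr_row_mx mul_col_row -!/(adj _) !dotE.
have pK := posmx_gram G; have [hK _] := pK.
(* The traces of the Gram matrix and of its square give the sum of the eigenvalues and the sum of
   their squares, hence the square of their difference. *)
have tr1 := trace_spectral 1%:M hK; have tr2 := trace_spectral (adj G *m G) hK.
exists (eigval (adj G *m G) 0), (eigval (adj G *m G) (lift 0 0)).
have sumE : eigval (adj G *m G) 0 + eigval (adj G *m G) (lift 0 0) =
    complex.Re (dot g0 g0) + complex.Re (dot g1 g1).
  move: tr1; rewrite mul1mx {1}KE mxtrace_block !mxtrace_scalar.
  move=> /(congr1 (@complex.Re R)); rewrite !mulr1n ReD Re_sum => ->; rewrite !big_ord_recl big_ord0 addr0.
  by rewrite !mul1mx !eigvec_ortho !eqxx !mulr1.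
have sqE : eigval (adj G *m G) 0 ^+ 2 + eigval (adj G *m G) (lift 0 0) ^+ 2 =
    complex.Re (dot g0 g0) ^+ 2 + complex.Re (dot g1 g1) ^+ 2 + normsq (dot g0 g1) *+ 2.
  move: tr2; rewrite {1 2}KE mulmx_block mxtrace_block -!scalar_mxM !mxtraceD.
  rewrite !mxtrace_scalar !mulr1n => /(congr1 (@complex.Re R)).
  rewrite Re_sum [RHS]big_ord_recl big_ord_recl big_ord0 addr0.
  rewrite !ReZ !dot_eigvec // -!expr2 => <-.
  rewrite -[dot g1 g0]dot_conj [dot g0 g1 * _]mulrC normsqE.
  rewrite [dot g0 g0]dot_real [dot g1 g1]dot_real -!rmorphXn -!rmorphD /=.
  ring.
split=> //; try exact: eigval_ge0.
- move: (congr1 (fun x => x ^+ 2) sumE) sqE => /=.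
  set a := eigval _ _; set b := eigval _ _ => h1 h2.
  have -> : (a - b) ^+ 2 = (a ^+ 2 + b ^+ 2) *+ 2 - (a + b) ^+ 2 by ring.
  by rewrite h1 h2; ring.
- by rewrite -scalerDr -GE vN_gram !big_ord_recl big_ord0 addr0.
Qed.

(** * Binary entropy and the bound for a single index *)

Lemma etaM (s p : R) : 0 < s -> 0 <= p ->
  Defs.eta (s * p) = s * Defs.eta p + p * Defs.eta s.
Proof.
move=> s0; rewrite le_eqVlt => /orP[/eqP <-|p0].
  by rewrite mulr0 !etaE !mul0r mulr0 addr0.
rewrite !etaE lnM ?posrE //; field.
by rewrite gt_eqF ?ln2_gt0.
Qed.

(** The grouping rule of Shannon entropy, for unnormalised weights. *)
Lemma eta_split (t a b : R) : 0 < t -> 0 <= a -> 0 <= b -> 0 < a + b ->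
  Defs.eta (t * a) + Defs.eta (t * b) =
  t * (a + b) * h (a / (a + b)) + Defs.eta (t * (a + b)).
Proof.
move=> t0 a0 b0 s0.
have s1 : a + b != 0 by rewrite gt_eqF.
have {1}-> : t * a = t * (a + b) * (a / (a + b)) by field.
have {1}-> : t * b = t * (a + b) * (1 - a / (a + b)) by field.
rewrite !(@etaM (t * (a + b))) ?mulr_gt0 ?divr_ge0 ?(ltW s0) //.
  by rewrite /h; ring.
by rewrite subr_ge0 ler_pdivrMr // mul1r lerDl.
Qed.

(* Gibbs' inequality bounds [h b] by the cross entropy of [b] relative to [a]. *)
Lemma h_decreasing (a b : R) : 1 / 2 <= a -> a <= b -> b <= 1 -> h b <= h a.
Proof.
move=> a2 ab b1; have [->//|anb] := eqVneq a b.
have {anb}ab : a < b by rewrite lt_def eq_sym anb.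
have a0 : 0 < a by lra.
have a1 : 0 < 1 - a by lra.
have b0 : 0 < b by lra.
have gibbs (x y : R) : 0 < x -> 0 <= y -> y * (ln x - ln y) <= x - y.
  move=> x0; rewrite le_eqVlt => /orP[/eqP <-|y0]; first by rewrite mul0r subr0 ltW.
  apply: le_trans (ler_wpM2l (ltW y0) (ln_sub_le y0 x0)) _.
  by rewrite mulrC divfK ?gt_eqF.
have g1 := gibbs a b a0 (ltW b0).
have b1' : 0 <= 1 - b by lra.
have g2 := gibbs (1 - a) (1 - b) a1 b1'.
have lna : ln (1 - a) <= ln a by rewrite ler_ln ?posrE //; lra.
have g3 : (b - a) * ln (1 - a) <= (b - a) * ln a by rewrite ler_wpM2l //; lra.
have hE x : h x = - (x * ln x + (1 - x) * ln (1 - x)) / ln 2 :> R.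
  by rewrite /h !etaE; ring.
by rewrite !hE ler_pM2r ?invr_gt0 ?ln2_gt0 //; lra.
Qed.

(** Both pairs have the same total, so after grouping only the binary entropies differ. Here [q]
    stands for the squared modulus of the inner product and [r] for its real part. *)
Lemma qubit_bound (t N0 N1 k0 k1 q r : R) :
  0 < t -> 0 <= N0 -> 0 <= N1 -> 0 <= k0 -> 0 <= k1 ->
  k0 + k1 = N0 + N1 -> (k0 - k1) ^+ 2 = (N0 - N1) ^+ 2 + 4 * q ->
  r ^+ 2 <= q ->
  t * (N0 + N1) * (if (0 < N0) && (0 < N1) then
     h (N0 / (N0 + N1)) - h (1 / 2 + Num.sqrt ((N0 - N1) ^+ 2 + 4 * r ^+ 2)
                                      / (2 * (N0 + N1))) else 0)
  <= Defs.eta (t * N0) + Defs.eta (t * N1)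
     - (Defs.eta (t * k0) + Defs.eta (t * k1)).
Proof.
move=> t0 N00 N10 k00 k10 ks kd rq.
wlog k01 : k0 k1 k00 k10 ks kd / k1 <= k0.
  move=> wl; have [|/ltW] := leP k1 k0; first exact: wl.
  rewrite [Defs.eta (t * k0) + _]addrC; apply: wl => //; first by rewrite addrC.
  by rewrite -sqrrN opprB.
case: ifP => [/andP[p0 p1]|/negbT].
  have s0 : 0 < N0 + N1 by rewrite addr_gt0.
  rewrite !eta_split ?ks //; set x := h _; set y := h _; set z := h (k0 / _).
  suff yz : z <= y.
    have : t * (N0 + N1) * z <= t * (N0 + N1) * y.
      by rewrite ler_wpM2l // ltW // mulr_gt0.
    by rewrite mulrBr; lra.
  set w := Num.sqrt _ in y *.
  have w0 : 0 <= w by exact: sqrtr_ge0.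
  (* Passing from [q] to [r ^+ 2] only shrinks the root, so lambda lies between 1/2 and
     [k0 / (k0 + k1)], where [h] decreases. *)
  have wk : w <= k0 - k1.
    rewrite -[leRHS]ger0_norm ?subr_ge0 // -sqrtr_sqr ler_wsqrtr // kd.
    by rewrite lerD2l ler_pM2l.
  apply: h_decreasing.
  - by rewrite lerDl divr_ge0 // mulr_ge0 // ltW.
  - have -> : 1 / 2 + w / (2 * (N0 + N1)) = (N0 + N1 + w) / 2 / (N0 + N1).
      by field; rewrite gt_eqF.
    by rewrite ler_pM2r ?invr_gt0 //; lra.
  - by rewrite ler_pdivrMr // mul1r -ks lerDl.
move=> np; have N01 : N0 * N1 = 0.
  apply/eqP; rewrite mulf_eq0; move: np.
  by rewrite negb_and -!leNgt => /orP[h0|h0]; apply/orP; [left|right];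
    rewrite eq_le h0.
(* With [N0 * N1 = 0], the square of [k0 - k1] is at least that of [N0 + N1 = k0 + k1], which forces
   [k0 * k1 <= 0]. *)
have k10' : k1 = 0.
  have kk : k0 * k1 <= 0 by nra.
  apply/eqP; rewrite eq_le k10 andbT; nra.
have k0s : k0 = N0 + N1 by lra.
have eta0 : Defs.eta (0 : R) = 0 by rewrite etaE mul0r.
rewrite mulr0 k10' k0s mulr0 eta0 addr0.
have /eqP := N01; rewrite mulf_eq0 => /orP[/eqP->|/eqP->].
  by rewrite mulr0 eta0 !add0r subrr.
by rewrite mulr0 eta0 !addr0 subrr.
Qed.

(** * Tensor products and block diagonal states *)

Lemma adj_tens m n p q (A : 'M[C]_(m, n)) (B : 'M[C]_(p, q)) :
  adj (mxtens.tensmx A B) = mxtens.tensmx (adj A) (adj B).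
Proof. by apply/matrixP => i j; rewrite !mxE rmorphM. Qed.

Lemma tens_adj m n (u v : 'cV[C]_m) (x y : 'cV[C]_n) :
  tens (u *m adj v) (x *m adj y) =
  mxtens.tensmx u x *m adj (mxtens.tensmx v y) :> 'M[C]_(m * n).
Proof.
by rewrite (adj_tens v y); symmetry; exact: mxtens.tensmx_mul.
Qed.

Lemma dot_tens m n (u v : 'cV[C]_m) (x y : 'cV[C]_n) :
  dot (mxtens.tensmx u x : 'cV[C]_(m * n)) (mxtens.tensmx v y) = dot u v * dot x y.
Proof.
rewrite /dot (adj_tens u x) -[RHS]mxtens.tensmxE.
have /matrixP/(_ 0 0) := mxtens.tensmx_mul (adj u) (adj x) v y.
by rewrite !ord1 => ->; congr (mxtens.tensmx _ _ _ _); exact/val_inj.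
Qed.

Lemma tens_sum m n (I : finType) (A : 'M[C]_m) (F : I -> 'M[C]_n) :
  tens A (\sum_i F i) = \sum_i tens A (F i).
Proof.
apply/matrixP => i j; rewrite summxE !mxE summxE mulr_sumr.
by apply: eq_bigr => k _; rewrite !mxE.
Qed.

Lemma tens_scale m n (a : C) (A : 'M[C]_m) (B : 'M[C]_n) :
  tens A (a *: B) = a *: tens A B.
Proof. by apply/matrixP => i j; rewrite !mxE mulrCA. Qed.

(** The products of [e b] with the eigenvectors of [X b] are orthonormal eigenvectors of the whole.
    They need not span the space; the complement has eigenvalue 0. *)
Lemma vN_cq m n (e : bool -> 'cV[C]_m) (X : bool -> 'M[C]_n) :
  (forall b c, dot (e b) (e c) = (b == c)%:R) -> (forall b, adj (X b) = X b) ->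
  vN (\sum_b tens (e b *m adj (e b)) (X b)) = \sum_b vN (X b).
Proof.
move=> eo hX.
pose v (p : bool * 'I_n) : 'cV[C]_(m * n) := mxtens.tensmx (e p.1) (eigvec (X p.1) p.2).
pose d (p : bool * 'I_n) := eigval (X p.1) p.2.
have rhoE : \sum_b tens (e b *m adj (e b)) (X b) =
    \sum_p (d p)%:C *: (v p *m adj (v p)).
  rewrite -(pair_bigA _ (fun b k => (d (b, k))%:C *: (v (b, k) *m adj (v (b, k))))) /=.
  apply: eq_bigr => b _; rewrite (herm_spectral (hX b)) tens_sum.
  by apply: eq_bigr => k _; rewrite tens_scale tens_adj.
have vv p q : dot (v p) (v q) = (p == q)%:R.
  rewrite dot_tens eo; case: p q => b k [c l] /=; rewrite -pair_eqE /=.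
  have [->|_] := eqVneq b c; last by rewrite mul0r.
  by rewrite eigvec_ortho mul1r.
rewrite (vN_family rhoE (d := d)) => [|p|p].
- by rewrite -(pair_bigA _ (fun b k => Defs.eta (d (b, k)))).
- rewrite rhoE mulmx_suml (bigD1 p) //= big1 ?addr0 => [|q /negPf qp].
    by rewrite -scalemxAl outer_mul vv eqxx scale1r.
  by rewrite -scalemxAl outer_mul vv qp scale0r scaler0.
- by rewrite vv eqxx mulr1.
Qed.

Lemma ptraceA_cq m n (e : bool -> 'cV[C]_m) (X : bool -> 'M[C]_n) :
  (forall b, dot (e b) (e b) = 1) ->
  ptraceA (\sum_b tens (e b *m adj (e b)) (X b)) = \sum_b X b.
Proof.
move=> e1; apply/matrixP => k l; rewrite mxE summxE.
under eq_bigr do rewrite summxE.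
rewrite exchange_big; apply: eq_bigr => b _.
under eq_bigr do rewrite mxtens.tensmxE.
rewrite -mulr_suml -[RHS]mul1r -(e1 b) /dot; congr (_ * _).
by rewrite [RHS]mxE; apply: eq_bigr => i _; rewrite !mxE big_ord1 !mxE mulrC.
Qed.

Lemma condS_cq m n (e : bool -> 'cV[C]_m) (X : bool -> 'M[C]_n) :
  (forall b c, dot (e b) (e c) = (b == c)%:R) -> (forall b, adj (X b) = X b) ->
  condS (\sum_b tens (e b *m adj (e b)) (X b)) =
  vN (X false) + vN (X true) - vN (X false + X true).
Proof.
move=> eo hX; rewrite /condS vN_cq // ptraceA_cq => [|b]; last by rewrite eo eqxx.
by rewrite !big_bool /= [vN (X true) + _]addrC [X true + _]addrC.
Qed.

End ConditionalEntropy.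

(* j in {0,1} is encoded by b : bool (false = 0, true = 1);
   i in {1,...,M} is encoded by i : 'I_M. *)
Theorem theorem1 (R : realType) (dA dE M : nat)
    (ket0 ket1 : 'cV[R[i]]_dA) (g : 'I_M -> bool -> 'cV[R[i]]_dE) (N : R) :
  (0 < M)%N ->
  adj ket0 *m ket0 = 1 -> adj ket1 *m ket1 = 1 -> adj ket0 *m ket1 = 0 ->
  0 < N ->
  let rho : 'M[R[i]]_(dA * dE) :=
    (N^-1)%:C *: (tens (ket0 *m adj ket0) (\sum_(i < M) g i false *m adj (g i false))
                + tens (ket1 *m adj ket1) (\sum_(i < M) g i true *m adj (g i true))) in
  density rho ->
  let Nij i b := complex.Re ((adj (g i b) *m g i b) 0 0) in
  let lambda i := 1 / 2 + Num.sqrt ((Nij i false - Nij i true) ^+ 2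
                     + 4 * (complex.Re ((adj (g i false) *m g i true) 0 0)) ^+ 2)
                   / (2 * (Nij i false + Nij i true)) in
  let S i := if (0 < Nij i false) && (0 < Nij i true)
             then h (Nij i false / (Nij i false + Nij i true)) - h (lambda i)
             else 0 in
  \sum_(i < M) ((Nij i false + Nij i true) / N) * S i <= condS rho.
Proof.
move=> _ n0 n1 n01 N0 rho _; cbv zeta.
pose t := N^-1.
have t0 : 0 < t by rewrite invr_gt0.
pose e b := if b then ket1 else ket0.
(* The factor [1 / N] is moved into every rank-one summand, so that the state is a plain sum over
   [i]. *)
pose x b i := t%:C *: (g i b *m adj (g i b)).
have eo b c : dot (e b) (e c) = (b == c)%:R.
  have n10 : dot ket1 ket0 = 0 by rewrite -dot_conj /dot n01 mxE conjc0.
  by case: b c => [] [] //=; rewrite /dot ?n0 ?n1 ?n01 mxE.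
have px b i : posmx (x b i) by exact: posmx_outer (ltW t0).
have rhoE : rho = \sum_b tens (e b *m adj (e b)) (\sum_i x b i).
  rewrite big_bool /= addrC /rho scalerDr -!tens_scale !scaler_sumr.
  by [].
rewrite rhoE condS_cq // => [|b]; last by case: (posmx_sum (px b)).
apply: le_trans (cond_entropy_sum (px false) (px true)).
apply: ler_sum => i _.
have [k0 [k1 [k00 k10 ks kd vE]]] := vN_outer2 t (g i false) (g i true).
rewrite /x vE !vN_outer [_ / N]mulrC.
(* The Gram spectrum involves the full squared modulus, lambda only the real part; the remaining
   goal compares the two. *)
apply: (qubit_bound (q := normsq (dot (g i false) (g i true)))) => //; try exact: dot_ge0.
by rewrite /normsq lerDl sqr_ge0.
Qed.
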